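(* For every integer $n\ge 1$ the following congruences hold: (i) $12\tau(n) \equiv 5n\sigma_3(n)+7n\sigma_5(n) \pmod{2^3\cdot 3\cdot 5\cdot 7}$; (ii) $32\tau(n) \equiv 15n\sigma(n)+ 50n^2\sigma_7(n)-33n\sigma_9(n) \pmod{2^5\cdot 3^2\cdot 5^2}$; (iii) $7\tau(n) \equiv 6n^2\sigma(n)- 9n^3\sigma_5(n) + 10 n^2\sigma_7(n) \pmod{2^4\cdot 3^3\cdot 7}$; (iv) $5\tau(n) \equiv 14 n^3\sigma(n)+ 12 n^4\sigma_3(n)- 21 n^3\sigma_5(n) \pmod{2^5\cdot 3\cdot 5\cdot 7}$; (v) $24\tau(n) \equiv 10 n\sigma(n)+ 25 n\sigma_7(n)- 11 n\sigma_9(n) \pmod{2^3\cdot 3\cdot 5^2}$; (vi) $14\tau(n) \equiv 9 n^2\sigma(n)+ 5 n^2\sigma_7(n) \pmod{2^3\cdot 3^3\cdot 7}$; (vii) $5\tau(n) \equiv 8 n^3\sigma(n)- 3 n^3\sigma_5(n) \pmod{2^5\cdot 3\cdot 5}$; (viii) $2\tau(n) \equiv n^2\sigma(n)+ n^2\sigma_5(n) \pmod{2^3\cdot 3}$.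
   Context: $\tau(n)$ is Ramanujan's tau function, defined by $q\prod_{n\ge 1}(1-q^n)^{24} = \sum_{n\ge 1}\tau(n)q^n$. For $k\ge 1$, $\sigma_k(n)=\sum_{d\mid n} d^k$ (sum over positive divisors of $n$), and $\sigma(n)=\sigma_1(n)$. *)

(* Defs.v *)
From mathcomp Require Import all_boot all_order all_algebra.

Set Implicit Arguments.
Unset Strict Implicit.
Unset Printing Implicit Defensive.

Import GRing.Theory.
Local Open Scope ring_scope.

(* The product q * prod_(m >= 1) (1 - q^m)^24, cut off after the factor m = N. *)
Definition delta_trunc (N : nat) : {poly int} :=
  'X * \prod_(1 <= m < N.+1) (1 - 'X^m) ^+ 24.

(* A factor with m > n does not affect the coefficient of q^n, so that the
   n-th coefficient of the infinite product can be read off any partial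
   product with N >= n; see delta_truncE below. *)
Definition tau (n : nat) : int := (delta_trunc n)`_n.

Definition sigma (k n : nat) : nat := (\sum_(d <- divisors n) d ^ k)%N.

Lemma delta_truncE (n N : nat) : (n <= N)%N -> (delta_trunc N)`_n = tau n.
Proof.
move=> /subnK <-; elim: (N - n)%N => [//|k <-]; rewrite addSn.
set M := (k + n)%N; have nM : (n <= M)%N by rewrite leq_addl.
have coef_fac (p : {poly int}) : (p * (1 - 'X^(M.+1)))`_n = p`_n.
  by rewrite mulrBr mulr1 coefB coefMXn ltnS nM subr0.
have -> : delta_trunc M.+1 = delta_trunc M * (1 - 'X^(M.+1)) ^+ 24.
  by rewrite /delta_trunc big_nat_recr //= mulrA.
by elim: 24%N => [|j IHj]; rewrite ?expr0 ?mulr1 // exprSr mulrA coef_fac.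
Qed.

(* Main.v *)
(**
Everything rests on convolution identities for divisor sums, obtained from the
positive solutions of a x + b y = n. If f(a + b, b) = f(a, a + b) =: g(a, b),
then (a, b, x, y) |-> (a - b, b, x, x + y) and its mirror image turn the sum of
f over the solutions with a <> b into the sum of g over those with x <> y, so
that the sum of (f - g)(a, b) over all solutions reduces to the diagonals
a = b and x = y, that is to divisor sums (Skoruppa). The polynomials
q = a^2 - a b + b^2 and r = (a b (a - b))^2 satisfy the condition; f = q, q^2,
r, q^3 and q r yield Ramanujan's differential equations for E2, E4, E6 as well
as E8 = E4^2 and E10 = E4 E6.

Logarithmic differentiation of the product gives D Delta = E2 Delta, where
D = q d/dq. By Ramanujan's equations E4^3 - E6^2 solves the same equation,
hence 1728 Delta = E4^3 - E6^2. Each congruence is then the reduction of an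
exact identity such as
  12 tau = 5 D s3 + 7 D s5 + 840 (2 s3 D s5 - 3 s5 D s3),
where s_k is the generating function of sigma_k: both sides are polynomials
in E2, D E2, D^2 E2 and D^3 E2, which agree modulo Chazy's equation.
*)
Require Import Defs.
From HB Require Import structures.
From mathcomp Require Import all_boot all_order all_algebra.
From mathcomp Require Import boolp.
From mathcomp Require Import ring zify.

Set Implicit Arguments.
Unset Strict Implicit.
Unset Printing Implicit Defensive.

Import GRing.Theory Num.Theory.
Local Open Scope ring_scope.

(** * Formal power series over the integers, with the Euler operator [q d/dq] *)

Record fps := Fps { coef : nat -> int }.

HB.instance Definition _ := gen_eqMixin fps.
HB.instance Definition _ := gen_choiceMixin fps.

Lemma fpsP (f g : fps) : coef f =1 coef g -> f = g.
Proof. by case: f g => [f] [g] /= /funext ->. Qed.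

Lemma fps_eq_pos (f g : fps) :
    coef f 0 = coef g 0 -> (forall n, (0 < n)%N -> coef f n = coef g n) ->
  f = g.
Proof. by move=> eq0 eqS; apply: fpsP => -[//|n]; apply: eqS. Qed.

(* The operations are locked because unification otherwise unfolds them when
   [rewrite] looks for a pattern in a large expression. *)
HB.lock Definition fps_add (f g : fps) : fps :=
  Fps (fun n => coef f n + coef g n).
HB.lock Definition fps_opp (f : fps) : fps := Fps (fun n => - coef f n).
HB.lock Definition fps_mul (f g : fps) : fps :=
  Fps (fun n => \sum_(i < n.+1) coef f i * coef g (n - i)).
HB.lock Definition euler (f : fps) : fps := Fps (fun n => n%:Z * coef f n).

Definition fps_zero : fps := Fps (fun=> 0).
Definition fps_poly (p : {poly int}) : fps := Fps (fun n => p`_n).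
Definition fps_trunc (n : nat) (f : fps) : {poly int} :=
  \poly_(i < n.+1) coef f i.

Lemma coef_trunc (f : fps) (n i : nat) :
  (i <= n)%N -> (fps_trunc n f)`_i = coef f i.
Proof. by move=> le_in; rewrite coef_poly ltnS le_in. Qed.

(** Coefficient [n] of a product involves only coefficients up to [n], so associativity,
    commutativity and the unit law for series follow from those for polynomials, applied to
    truncations at [n]. *)
Lemma coef_fps_mul (f g : fps) (p q : {poly int}) (n : nat) :
    (forall i, (i <= n)%N -> coef f i = p`_i) ->
    (forall i, (i <= n)%N -> coef g i = q`_i) ->
  coef (fps_mul f g) n = (p * q)`_n.
Proof.
move=> fp gq; rewrite fps_mul.unlock coefM; apply: eq_bigr => i _.
by rewrite fp ?gq ?leq_subr // -ltnS.
Qed.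

Lemma fps_addA : associative fps_add.
Proof.
by move=> f g h; apply: fpsP => n; rewrite fps_add.unlock /= addrA.
Qed.

Lemma fps_addC : commutative fps_add.
Proof. by move=> f g; apply: fpsP => n; rewrite fps_add.unlock /= addrC. Qed.

Lemma fps_add0 : left_id fps_zero fps_add.
Proof. by move=> f; apply: fpsP => n; rewrite fps_add.unlock /= add0r. Qed.

Lemma fps_addN : left_inverse fps_zero fps_opp fps_add.
Proof.
move=> f; apply: fpsP => n.
by rewrite fps_add.unlock fps_opp.unlock /= addNr.
Qed.

HB.instance Definition _ :=
  GRing.isZmodule.Build fps fps_addA fps_addC fps_add0 fps_addN.

Lemma fps_mulA : associative fps_mul.
Proof.
move=> f g h; apply: fpsP => n.
pose F := fps_trunc n f; pose G := fps_trunc n g; pose H := fps_trunc n h.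
have tr (u : fps) i : (i <= n)%N -> coef u i = (fps_trunc n u)`_i.
  by move=> le_in; rewrite coef_trunc.
have tr2 (u v : fps) i : (i <= n)%N ->
    coef (fps_mul u v) i = (fps_trunc n u * fps_trunc n v)`_i.
  by move=> le_in; apply: coef_fps_mul => j le_ji; apply: tr;
    apply: leq_trans le_in.
rewrite (coef_fps_mul (p := F) (q := G * H)); [|exact: tr|exact: tr2].
rewrite (coef_fps_mul (p := F * G) (q := H)); [|exact: tr2|exact: tr].
by rewrite mulrA.
Qed.

Lemma fps_mulC : commutative fps_mul.
Proof.
move=> f g; apply: fpsP => n.
have tr (u : fps) i : (i <= n)%N -> coef u i = (fps_trunc n u)`_i.
  by move=> le_in; rewrite coef_trunc.
by rewrite !(coef_fps_mul (tr _) (tr _)) mulrC.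
Qed.

Lemma fps_mul1 : left_id (fps_poly 1) fps_mul.
Proof.
move=> f; apply: fpsP => n.
have tr i : (i <= n)%N -> coef f i = (fps_trunc n f)`_i.
  by move=> le_in; rewrite coef_trunc.
by rewrite (coef_fps_mul (p := 1) _ tr) // mul1r coef_trunc.
Qed.

Lemma coef_fpsD (f g : fps) (n : nat) : coef (f + g) n = coef f n + coef g n.
Proof. by rewrite -[f + g]/(fps_add f g) fps_add.unlock. Qed.

Lemma coef_fpsN (f : fps) (n : nat) : coef (- f) n = - coef f n.
Proof. by rewrite -[- f]/(fps_opp f) fps_opp.unlock. Qed.

Lemma fps_mulDl : left_distributive fps_mul +%R.
Proof.
move=> f g h; apply: fpsP => n; rewrite coef_fpsD fps_mul.unlock /=.
rewrite -big_split /=.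
by apply: eq_bigr => i _; rewrite coef_fpsD mulrDl.
Qed.

Lemma fps_oner_neq0 : fps_poly 1 != 0.
Proof. by apply/eqP => /(congr1 (coef^~ 0)) /=; rewrite coefC. Qed.

HB.instance Definition _ := GRing.Zmodule_isComNzRing.Build fps
  fps_mulA fps_mulC fps_mul1 fps_mulDl fps_oner_neq0.

Lemma coef_fpsM (f g : fps) (n : nat) :
  coef (f * g) n = \sum_(i < n.+1) coef f i * coef g (n - i).
Proof. by rewrite -[f * g]/(fps_mul f g) fps_mul.unlock. Qed.

Lemma coef_fps1 (n : nat) : coef 1 n = (n == 0)%:R.
Proof. by rewrite [LHS]/= coefC; case: eqP. Qed.

Lemma coef_fpsMn (f : fps) (c n : nat) : coef (f *+ c) n = c%:R * coef f n.
Proof.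
elim: c => [|c IHc]; first by rewrite mul0r.
by rewrite mulrSr coef_fpsD IHc -[c.+1]addn1 natrD mulrDl mul1r.
Qed.

Lemma coef_fps_natM (c : nat) (f : fps) (n : nat) :
  coef (c%:R * f) n = c%:R * coef f n.
Proof. by rewrite mulr_natl coef_fpsMn. Qed.

(** Cancels the factors by which identities are multiplied in order to avoid denominators. *)
Lemma natM_inj (c : nat) (f g : fps) :
  (0 < c)%N -> c%:R * f = c%:R * g -> f = g.
Proof.
move=> c_gt0 eq_cfg; apply: fpsP => n; have /(congr1 (coef^~ n)) := eq_cfg.
rewrite !coef_fps_natM; apply: mulfI.
by rewrite pnatr_eq0 -lt0n.
Qed.

Lemma coef_euler (f : fps) (n : nat) : coef (euler f) n = n%:Z * coef f n.
Proof. by rewrite euler.unlock. Qed.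

Lemma coef_fps0M (f g : fps) : coef (f * g) 0 = coef f 0 * coef g 0.
Proof. by rewrite coef_fpsM big_ord_recl big_ord0 addr0. Qed.

Definition coef_fpsE := (coef_fpsD, coef_fpsN, coef_fps_natM, coef_euler).

Lemma eulerD : {morph euler : f g / f + g}.
Proof.
by move=> f g; apply: fpsP => n; rewrite !(coef_fpsD, coef_euler) mulrDr.
Qed.

Lemma eulerN : {morph euler : f / - f}.
Proof.
by move=> f; apply: fpsP => n; rewrite !(coef_fpsN, coef_euler) mulrN.
Qed.

Lemma eulerM (f g : fps) : euler (f * g) = euler f * g + f * euler g.
Proof.
apply: fpsP => n; rewrite coef_fpsD coef_euler !coef_fpsM -big_split /=.
rewrite mulr_sumr; apply: eq_bigr => i _.
rewrite !coef_euler -{1}(subnKC (ltn_ord i : (i <= n)%N)) PoszD.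
ring.
Qed.

Lemma euler1 : euler 1 = 0.
Proof.
by apply: fpsP => -[|n]; rewrite coef_euler coef_fps1 ?mul0r // mulr0.
Qed.

Lemma euler_nat (c : nat) : euler c%:R = 0.
Proof.
elim: c => [|c IHc]; first by apply: fpsP => n; rewrite coef_euler mulr0.
by rewrite -natr1 eulerD IHc euler1 addr0.
Qed.

Lemma euler_natM (c : nat) (f : fps) : euler (c%:R * f) = c%:R * euler f.
Proof. by rewrite eulerM euler_nat mul0r add0r. Qed.

Lemma fps_polyM : {morph fps_poly : p q / p * q}.
Proof. by move=> p q; apply: fpsP => n; rewrite coef_fpsM /= coefM. Qed.

(** * Generating series of divisor sums *)

(* [divisors 0 = [:: 1]], so the constant coefficient must be set to 0. *)
Definition sigma_gf (k : nat) : fps :=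
  Fps (fun n => if n is 0%N then 0 else (sigma k n)%:Z).

Lemma coef_sigma_gf (k n : nat) :
  (0 < n)%N -> coef (sigma_gf k) n = (sigma k n)%:Z.
Proof. by case: n. Qed.

Lemma sigmaZ (k n : nat) :
  (sigma k n)%:Z = \sum_(d <- divisors n) d%:Z ^+ k.
Proof.
rewrite raddf_sum; apply: eq_bigr => d _.
by elim: k => [//|k IHk]; rewrite expnS exprS -IHk.
Qed.

(** * The positive solutions of [a x + b y = n] *)

Lemma big_seq_bij (I J : eqType) (s : seq I) (r : seq J)
    (phi : J -> I) (psi : I -> J) (F : I -> int) :
    uniq s -> uniq r ->
    {in r, forall j, phi j \in s /\ psi (phi j) = j} ->
    {in s, forall i, psi i \in r /\ phi (psi i) = i} ->
  \sum_(i <- s) F i = \sum_(j <- r) F (phi j).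
Proof.
move=> s_uniq r_uniq phiP psiP; rewrite -(big_map phi predT F).
apply: perm_big; apply: uniq_perm => //.
  by rewrite map_inj_in_uniq // => i j /phiP[_ {2}<-] /phiP[_ {2}<-] ->.
move=> i; apply/idP/mapP => [/psiP[ri <-]|[j /phiP[sj _] ->] //].
by exists (psi i).
Qed.

(* [((a, b), (x, y)) \in quads n] iff a, b, x, y > 0 and a x + b y = n. *)
Definition quads (n : nat) : seq ((nat * nat) * (nat * nat)) :=
  let pairs := [seq (u, v) | u <- iota 1 n, v <- iota 1 n] in
  [seq t <- [seq (p, r) | p <- pairs, r <- pairs]
     | (t.1.1 * t.2.1 + t.1.2 * t.2.2 == n)%N].

Lemma quads_uniq (n : nat) : uniq (quads n).
Proof.
have pair_inj (T U : eqType) (A : seq (T * U)) :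
    {in A &, injective (uncurry (@pair T U))}.
  by move=> [? ?] [? ?] _ _ [-> ->].
by apply: filter_uniq; rewrite !allpairs_uniq ?iota_uniq.
Qed.

Lemma mem_quads (n a b x y : nat) :
  (((a, b), (x, y)) \in quads n) =
  [&& 0 < a, 0 < b, 0 < x, 0 < y & a * x + b * y == n]%N.
Proof.
have mem_pairs (T U : eqType) (s : seq T) (r : seq U) u v :
    ((u, v) \in [seq (u, v) | u <- s, v <- r]) = (u \in s) && (v \in r).
  apply/allpairsP/andP => [[p [su rv]] [-> ->] //|[su rv]].
  by exists (u, v).
rewrite mem_filter !mem_pairs !mem_iota /=.
have [def_n|] := eqVneq; last by rewrite !andbF.
rewrite andTb andbT.
have [a0|a_gt0] := posnP a; first by rewrite ?andbF.
have [b0|b_gt0] := posnP b; first by rewrite ?andbF.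
have [x0|x_gt0] := posnP x; first by rewrite ?andbF.
have [y0|y_gt0] := posnP y; first by rewrite ?andbF.
rewrite !add1n !ltnS -def_n /=.
have le_l u v w : (0 < v -> u <= u * v + w)%N.
  by move=> v0; rewrite (leq_trans (leq_pmulr u v0)) ?leq_addr.
have le_r u v w : (0 < v -> u <= w + u * v)%N by rewrite addnC; apply: le_l.
by rewrite le_l // le_r // (mulnC a) (mulnC b) le_l // le_r.
Qed.

Lemma quadsP (n : nat) (t : (nat * nat) * (nat * nat)) :
  reflect [/\ 0 < t.1.1, 0 < t.1.2, 0 < t.2.1, 0 < t.2.2 &
              t.1.1 * t.2.1 + t.1.2 * t.2.2 = n]%N
          (t \in quads n).
Proof.
case: t => [[a b] [x y]] /=; rewrite mem_quads.
by apply: (iffP and5P) => -[a0 b0 x0 y0 /eqP def_n]; split.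
Qed.

(** The solutions are grouped by [m = a x]: then [a] runs over the divisors of [m] and,
    independently, [b] over those of [n - m], while [x] and [y] are the cofactors. *)
Lemma sum_quads_mul (i j n : nat) :
  \sum_(t <- quads n) t.1.1%:Z ^+ i * t.1.2%:Z ^+ j =
  coef (sigma_gf i * sigma_gf j) n.
Proof.
rewrite coef_fpsM.
rewrite (partition_big (fun t => inord (t.1.1 * t.2.1) : 'I_n.+1) predT) //.
apply: eq_bigr => m _; have le_mn : (m <= n)%N by rewrite -ltnS.
rewrite -big_filter; set s := filter _ _.
have mem_s t : reflect (t \in quads n /\ t.1.1 * t.2.1 = m)%N (t \in s).
  rewrite [X in reflect _ X]mem_filter andbC -val_eqE /=.
  apply: (iffP andP) => -[tn].
    have le_tn : (t.1.1 * t.2.1 <= n)%N.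
      by case/quadsP: tn => _ _ _ _ <-; apply: leq_addr.
    by rewrite inordK // => /eqP.
  by move=> tm; split=> //; rewrite inordK tm.
have s_uniq : uniq s by rewrite filter_uniq ?quads_uniq.
(* For [m = 0] and [m = n] there is no solution, as all four numbers are positive, and the product
   of coefficients vanishes, as [sigma_gf] has no constant term. *)
case: (posnP m) => [m0|m_gt0].
  have ->: coef (sigma_gf i) m = 0 by rewrite m0.
  rewrite mul0r big1_seq // => t /= /mem_s[/quadsP[a0 _ x0 _ _]].
  by rewrite m0 => /eqP; rewrite muln_eq0 !gtn_eqF.
case: (posnP (n - m)) => [m0|nm_gt0].
  have ->: coef (sigma_gf j) (n - m) = 0 by rewrite m0.
  rewrite mulr0 big1_seq // => t /= /mem_s[/quadsP[_ b0 _ y0 def_n]].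
  move=> def_m; move: m0; rewrite -{1}def_n -def_m addKn => /eqP.
  by rewrite muln_eq0 !gtn_eqF.
pose r := [seq (a, b) | a <- divisors m, b <- divisors (n - m)].
rewrite (big_seq_bij (r := r) (psi := fst)
  (phi := fun p => (p, ((m %/ p.1)%N, ((n - m) %/ p.2)%N)))) //.
- rewrite big_allpairs !coef_sigma_gf // !sigmaZ mulr_suml.
  by apply: eq_bigr => a _; rewrite mulr_sumr.
- by apply: allpairs_uniq (divisors_uniq _) (divisors_uniq _) _;
    move=> [? ?] [? ?] _ _ [-> ->].
- move=> [a b] /allpairsP[[u v] [/= am bm [-> ->]]]; split=> //.
  move: am bm; rewrite -!dvdn_divisors // => am bm.
  apply/mem_s; split=> /=; last by rewrite mulnC (divnK am).
  have [a_gt0 b_gt0] := (dvdn_gt0 m_gt0 am, dvdn_gt0 nm_gt0 bm).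
  rewrite mem_quads !divn_gt0 // (dvdn_leq m_gt0 am) (dvdn_leq nm_gt0 bm).
  rewrite a_gt0 b_gt0 /=.
  by rewrite mulnC divnK // mulnC divnK // subnKC ?eqxx.
- move=> [[a b] [x y]] /mem_s[/quadsP[/= a0 b0 x0 y0 def_n] def_m]; split.
    apply: allpairs_f; rewrite -dvdn_divisors //=.
      by rewrite -def_m dvdn_mulr.
    by rewrite -{1}def_n -def_m addKn dvdn_mulr.
  have -> : (n - m = b * y)%N by rewrite -{1}def_n -def_m addKn.
  by rewrite -def_m !mulKn.
Qed.

Lemma mem_filter_quads (P : pred ((nat * nat) * (nat * nat)))
    (n a b x y : nat) :
  (((a, b), (x, y)) \in [seq t <- quads n | P t]) =
  P ((a, b), (x, y)) &&
  [&& 0 < a, 0 < b, 0 < x, 0 < y & a * x + b * y == n]%N.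
Proof. by rewrite mem_filter mem_quads. Qed.

(** A step of Euclid's algorithm: [a x + b y = (a - b) x + b (x + y)], and [b < a] corresponds to
    [x < x + y]. *)
Lemma quads_shift_l (n : nat) (f : nat -> nat -> int) :
  \sum_(t <- quads n | (t.1.2 < t.1.1)%N) f t.1.1 t.1.2 =
  \sum_(t <- quads n | (t.2.1 < t.2.2)%N) f (t.1.1 + t.1.2)%N t.1.2.
Proof.
rewrite -big_filter -[RHS]big_filter.
apply: (big_seq_bij
  (phi := fun t => ((t.1.1 + t.1.2, t.1.2), (t.2.1, t.2.2 - t.2.1))%N)
  (psi := fun t => ((t.1.1 - t.1.2, t.1.2), (t.2.1, t.2.1 + t.2.2))%N)).
1, 2: by rewrite filter_uniq ?quads_uniq.
all: move=> [[a b] [x y]]; rewrite !mem_filter_quads /=.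
all: move=> /andP[lt_ab /and5P[? ? ? ? /eqP <-]]; split.
1, 3: by apply/andP; split; [lia|apply/and5P; split; try lia; apply/eqP; nia].
all: by congr (_, _); congr (_, _); lia.
Qed.

Lemma quads_shift_r (n : nat) (f : nat -> nat -> int) :
  \sum_(t <- quads n | (t.1.1 < t.1.2)%N) f t.1.1 t.1.2 =
  \sum_(t <- quads n | (t.2.2 < t.2.1)%N) f t.1.1 (t.1.1 + t.1.2)%N.
Proof.
rewrite -big_filter -[RHS]big_filter.
apply: (big_seq_bij
  (phi := fun t => ((t.1.1, t.1.1 + t.1.2), (t.2.1 - t.2.2, t.2.2))%N)
  (psi := fun t => ((t.1.1, t.1.2 - t.1.1), (t.2.1 + t.2.2, t.2.2))%N)).
1, 2: by rewrite filter_uniq ?quads_uniq.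
all: move=> [[a b] [x y]]; rewrite !mem_filter_quads /=.
all: move=> /andP[lt_ab /and5P[? ? ? ? /eqP <-]]; split.
1, 3: by apply/andP; split; [lia|apply/and5P; split; try lia; apply/eqP; nia].
all: by congr (_, _); congr (_, _); lia.
Qed.

(** With [a = b = d] the equation becomes [d (x + y) = n], so [d] divides [n] and [x] takes
    [n / d - 1] values. *)
Lemma quads_diag_l (n : nat) (f : nat -> int) : (0 < n)%N ->
  \sum_(t <- quads n | t.1.1 == t.1.2) f t.1.1 =
  \sum_(d <- divisors n) ((n %/ d)%:Z - 1) * f d.
Proof.
move=> n_gt0; rewrite -big_filter.
pose r := [seq (d, x) | d <- divisors n, x <- iota 1 (n %/ d).-1].
rewrite (big_seq_bij (r := r) (psi := fun t => (t.1.1, t.2.1))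
  (phi := fun p => ((p.1, p.1), (p.2, n %/ p.1 - p.2))%N)).
- rewrite big_allpairs_dep; apply: eq_big_seq => d.
  rewrite -dvdn_divisors // => dn.
  rewrite /= big_const_seq count_predT size_iota iter_addr_0 -mulr_natl.
  have := divn_gt0 n (dvdn_gt0 n_gt0 dn); rewrite (dvdn_leq n_gt0 dn) => q_gt0.
  by congr (_ * _); lia.
- by rewrite filter_uniq ?quads_uniq.
- apply: allpairs_uniq_dep => [|d _|[? ?] [? ?] _ _ [-> ->] //].
    exact: divisors_uniq.
  exact: iota_uniq.
- move=> [d x] /allpairsPdep[u [v [/= dn xr [-> ->]]]]; split=> //.
  move: dn xr; rewrite -dvdn_divisors // mem_iota => dn xr.
  rewrite mem_filter_quads eqxx /=; have d_gt0 := dvdn_gt0 n_gt0 dn.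
  rewrite -mulnDr subnKC; last by lia.
  by rewrite mulnC divnK ?eqxx //; lia.
- move=> [[a b] [x y]]; rewrite mem_filter_quads /=.
  move=> /andP[/eqP <- /and5P[a0 _ x0 y0 /eqP def_n]].
  have def_q : (n %/ a = x + y)%N by rewrite -def_n -mulnDr mulKn.
  split; last by rewrite def_q addKn.
  apply/allpairsPdep; exists a, x; split=> //.
    by rewrite -dvdn_divisors // -def_n -mulnDr dvdn_mulr.
  by rewrite mem_iota def_q; lia.
Qed.

(** With [x = y] the equation becomes [(a + b) x = n], so [d = a + b] divides [n] and [b] is any
    positive number below [d]. *)
Lemma quads_diag_r (n : nat) (f : nat -> nat -> int) : (0 < n)%N ->
  \sum_(t <- quads n | t.2.1 == t.2.2) f (t.1.1 + t.1.2)%N t.1.2 =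
  \sum_(d <- divisors n) \sum_(1 <= b < d) f d b.
Proof.
move=> n_gt0; rewrite -big_filter.
pose r := [seq (d, b) | d <- divisors n, b <- index_iota 1 d].
rewrite (big_seq_bij (r := r) (psi := fun t => (t.1.1 + t.1.2, t.1.2)%N)
  (phi := fun p => ((p.1 - p.2, p.2), (n %/ p.1, n %/ p.1))%N)).
- rewrite big_allpairs_dep; apply: eq_bigr => d _; apply: eq_big_nat => b ltbd.
  by congr (f _ _) => /=; lia.
- by rewrite filter_uniq ?quads_uniq.
- apply: allpairs_uniq_dep => [|d _|[? ?] [? ?] _ _ [-> ->] //].
    exact: divisors_uniq.
  exact: iota_uniq.
- move=> [d x] /allpairsPdep[u [v [/= dn xr [-> ->]]]].
  move: dn xr; rewrite -dvdn_divisors // mem_index_iota => dn xr.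
  split; last by congr (_, _); lia.
  rewrite mem_filter_quads eqxx /= divn_gt0 ?(dvdn_gt0 n_gt0 dn) //.
  rewrite (dvdn_leq n_gt0 dn) -mulnDl subnK; last by lia.
  by rewrite mulnC divnK ?eqxx //; lia.
- move=> [[a b] [x y]]; rewrite mem_filter_quads /=.
  move=> /andP[/eqP <- /and5P[a0 b0 x0 _ /eqP def_n]].
  have def_q : (n %/ (a + b) = x)%N.
    by rewrite -def_n -mulnDl mulKn // addn_gt0 a0.
  split; last by rewrite def_q addnK.
  apply/allpairsPdep; exists (a + b)%N, b; split=> //.
    by rewrite -dvdn_divisors // -def_n -mulnDl dvdn_mulr.
  by rewrite mem_index_iota; lia.
Qed.

Lemma sum_quads_rotation (n : nat) (f : nat -> nat -> int) : (0 < n)%N ->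
    (forall a b, f (a + b)%N b = f a (a + b)%N) ->
  \sum_(t <- quads n) (f t.1.1 t.1.2 - f (t.1.1 + t.1.2)%N t.1.2) =
  \sum_(d <- divisors n)
    (((n %/ d)%:Z - 1) * f d d - \sum_(1 <= b < d) f d b).
Proof.
move=> n_gt0 f_rot; rewrite !sumrB -quads_diag_r //.
rewrite -(quads_diag_l (fun d => f d d)) //.
have trich (u v : (nat * nat) * (nat * nat) -> nat) F :
    \sum_(t <- quads n) F t =
    \sum_(t <- quads n | (v t < u t)%N) F t +
    \sum_(t <- quads n | (u t < v t)%N) F t +
    \sum_(t <- quads n | u t == v t) F t :> int.
  rewrite (bigID (fun t => v t < u t)%N) /= -addrA; congr (_ + _).
  rewrite (bigID (fun t => u t < v t)%N) /=; congr (_ + _).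
    by apply: eq_bigl => t; lia.
  by apply: eq_bigl => t; lia.
(* The sum of [f] is split by comparing [a] with [b], that of the shifted function by comparing [x]
   with [y]. The off-diagonal parts then agree, for the mirror image by [f_rot]. *)
rewrite (trich (fun t => t.1.1) (fun t => t.1.2)) quads_shift_l quads_shift_r.
rewrite (trich (fun t => t.2.1) (fun t => t.2.2) (fun t => f _ _)).
under [X in _ + X + _ - _]eq_bigr => t _ do rewrite -f_rot.
have -> : \sum_(t <- quads n | t.1.1 == t.1.2) f t.1.1 t.1.2 =
          \sum_(t <- quads n | t.1.1 == t.1.2) f t.1.1 t.1.1.
  by apply: eq_bigr => t /eqP ->.
ring.
Qed.

(** Over [int] the symmetry of a polynomial [f] is a ring identity, and [c] clears the denominators
    of the power sum. Closed forms at [d = m + 1] suffice because divisors of [n] are positive. *)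
Lemma sum_quads_rotationZ (n : nat) (c : int) (f : int -> int -> int)
    (h : int -> int) : (0 < n)%N ->
    (forall a b, f (a + b) b = f a (a + b)) ->
    (forall m : nat, c * \sum_(1 <= b < m.+1) f m.+1%:Z b%:Z = h m.+1%:Z) ->
  c * \sum_(t <- quads n)
        (f t.1.1%:Z t.1.2%:Z - f (t.1.1%:Z + t.1.2%:Z) t.1.2%:Z) =
  \sum_(d <- divisors n) (c * ((n %/ d)%:Z - 1) * f d%:Z d%:Z - h d%:Z).
Proof.
move=> n_gt0 f_rot f_sum.
have := sum_quads_rotation (f := fun a b => f a%:Z b%:Z) n_gt0 _.
move=> /(_ _)/(congr1 ( *%R c)) ->; last by move=> a b; rewrite PoszD f_rot.
rewrite mulr_sumr; apply: eq_big_seq => d; rewrite -dvdn_divisors // => dn.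
have [m ->] : exists m, d = m.+1.
  by exists d.-1; rewrite prednK // (dvdn_gt0 n_gt0).
by rewrite mulrBr f_sum mulrA.
Qed.

(** * Five convolution identities for divisor sums *)

(* The closed forms are Faulhaber sums; at m = d - 1 only odd powers of d
   survive, apart from the d ^ 2k of f = q ^ k, so that the divisor sums are
   combinations of sigma_j with j odd. *)
Lemma sum_q1 (d : int) (m : nat) :
  6 * \sum_(1 <= b < m.+1)
         (d ^+ 2 - d * b%:Z + b%:Z ^+ 2) =
    6 * d ^+ 2 * m%:Z - 3 * d * m%:Z ^+ 2 - 3 * d * m%:Z + 2 * m%:Z ^+ 3 +
    3 * m%:Z ^+ 2 + m%:Z.
Proof.
elim: m => [|m IHm]; first by rewrite big_geq //; ring.
by rewrite big_nat_recr //= mulrDr IHm intS; ring.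
Qed.

(** Here [f = q]. All five functions used satisfy [f(a + b, b) = f(a, -b)], so the difference is odd
    in [a] and in [b] and only odd indices occur in the products; for [q] it is [- 2 a b]. On the
    diagonal, [(n / d) d^2 = n d] produces the [euler] term. *)
Lemma sigma_conv_1_1 :
  12 * (sigma_gf 1 * sigma_gf 1) =
  5 * sigma_gf 3 + sigma_gf 1 - 6 * euler (sigma_gf 1).
Proof.
apply: fps_eq_pos => [|n n_gt0].
  by rewrite !(coef_fpsE, coef_fps0M) /=; ring.
pose f (a b : int) := (a ^+ 2 - a * b + b ^+ 2).
pose h (d : int) := 5 * d ^+ 3 + d - 6 * d ^+ 2.
have f_rot a b : f (a + b) b = f a (a + b) by rewrite /f; ring.
have f_sum (m : nat) :
    6 * \sum_(1 <= b < m.+1) f m.+1%:Z b%:Z = h m.+1%:Z.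
  by rewrite sum_q1 /h intS; ring.
have := sum_quads_rotationZ n_gt0 f_rot f_sum.
have -> : \sum_(t <- quads n)
    (f t.1.1%:Z t.1.2%:Z - f (t.1.1%:Z + t.1.2%:Z) t.1.2%:Z) =
  (-2) * coef (sigma_gf 1 * sigma_gf 1) n.
  rewrite -!sum_quads_mul !mulr_sumr -?big_split /=.
  by apply: eq_bigr => t _; rewrite /f; ring.
have -> : \sum_(d <- divisors n)
    (6 * ((n %/ d)%:Z - 1) * f d%:Z d%:Z - h d%:Z) =
  (-5) * (sigma 3 n)%:Z + (-1) * (sigma 1 n)%:Z + 6 * (n%:Z * (sigma 1 n)%:Z).
  rewrite !sigmaZ !mulr_sumr -!big_split /=.
  apply: eq_big_seq => d; rewrite -dvdn_divisors // => dn.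
  by rewrite -{2}(divnK dn) PoszM /f /h; ring.
rewrite !coef_fpsE !coef_sigma_gf //.
lia.
Qed.

Lemma sum_q2 (d : int) (m : nat) :
  30 * \sum_(1 <= b < m.+1)
         ((d ^+ 2 - d * b%:Z + b%:Z ^+ 2) ^+ 2) =
    30 * d ^+ 4 * m%:Z - 30 * d ^+ 3 * m%:Z ^+ 2 - 30 * d ^+ 3 * m%:Z +
    30 * d ^+ 2 * m%:Z ^+ 3 + 45 * d ^+ 2 * m%:Z ^+ 2 + 15 * d ^+ 2 * m%:Z -
    15 * d * m%:Z ^+ 4 - 30 * d * m%:Z ^+ 3 - 15 * d * m%:Z ^+ 2 +
    6 * m%:Z ^+ 5 + 15 * m%:Z ^+ 4 + 10 * m%:Z ^+ 3 - m%:Z.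
Proof.
elim: m => [|m IHm]; first by rewrite big_geq //; ring.
by rewrite big_nat_recr //= mulrDr IHm intS; ring.
Qed.

Lemma sigma_conv_1_3 :
  240 * (sigma_gf 1 * sigma_gf 3) =
  21 * sigma_gf 5 + 10 * sigma_gf 3 - sigma_gf 1 - 30 * euler (sigma_gf 3).
Proof.
apply: fps_eq_pos => [|n n_gt0].
  by rewrite !(coef_fpsE, coef_fps0M) /=; ring.
pose f (a b : int) := (a ^+ 2 - a * b + b ^+ 2) ^+ 2.
pose h (d : int) := 21 * d ^+ 5 + 10 * d ^+ 3 - d - 30 * d ^+ 4.
have f_rot a b : f (a + b) b = f a (a + b) by rewrite /f; ring.
have f_sum (m : nat) :
    30 * \sum_(1 <= b < m.+1) f m.+1%:Z b%:Z = h m.+1%:Z.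
  by rewrite sum_q2 /h intS; ring.
have := sum_quads_rotationZ n_gt0 f_rot f_sum.
have -> : \sum_(t <- quads n)
    (f t.1.1%:Z t.1.2%:Z - f (t.1.1%:Z + t.1.2%:Z) t.1.2%:Z) =
  (-4) * coef (sigma_gf 3 * sigma_gf 1) n +
    (-4) * coef (sigma_gf 1 * sigma_gf 3) n.
  rewrite -!sum_quads_mul !mulr_sumr -?big_split /=.
  by apply: eq_bigr => t _; rewrite /f; ring.
have -> : \sum_(d <- divisors n)
    (30 * ((n %/ d)%:Z - 1) * f d%:Z d%:Z - h d%:Z) =
  (-21) * (sigma 5 n)%:Z + (-10) * (sigma 3 n)%:Z + (sigma 1 n)%:Z +
    30 * (n%:Z * (sigma 3 n)%:Z).
  rewrite !sigmaZ !mulr_sumr -!big_split /=.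
  apply: eq_big_seq => d; rewrite -dvdn_divisors // => dn.
  by rewrite -{2}(divnK dn) PoszM /f /h; ring.
rewrite (_ : sigma_gf 3 * sigma_gf 1 = sigma_gf 1 * sigma_gf 3);
  last by rewrite mulrC.
rewrite !coef_fpsE !coef_sigma_gf //.
lia.
Qed.

Lemma sum_r1 (d : int) (m : nat) :
  30 * \sum_(1 <= b < m.+1)
         ((d * b%:Z * (d - b%:Z)) ^+ 2) =
    10 * d ^+ 4 * m%:Z ^+ 3 + 15 * d ^+ 4 * m%:Z ^+ 2 + 5 * d ^+ 4 * m%:Z -
    15 * d ^+ 3 * m%:Z ^+ 4 - 30 * d ^+ 3 * m%:Z ^+ 3 -
    15 * d ^+ 3 * m%:Z ^+ 2 + 6 * d ^+ 2 * m%:Z ^+ 5 +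
    15 * d ^+ 2 * m%:Z ^+ 4 + 10 * d ^+ 2 * m%:Z ^+ 3 - d ^+ 2 * m%:Z.
Proof.
elim: m => [|m IHm]; first by rewrite big_geq //; ring.
by rewrite big_nat_recr //= mulrDr IHm intS; ring.
Qed.

(** Here [f = r] vanishes for [a = b], hence there is no [euler] term; the difference is
    [- 4 a^3 b^3]. *)
Lemma sigma_conv_3_3 :
  120 * (sigma_gf 3 * sigma_gf 3) =
  sigma_gf 7 - sigma_gf 3.
Proof.
apply: fps_eq_pos => [|n n_gt0].
  by rewrite !(coef_fpsE, coef_fps0M) /=; ring.
pose f (a b : int) := (a * b * (a - b)) ^+ 2.
pose h (d : int) := d ^+ 7 - d ^+ 3.
have f_rot a b : f (a + b) b = f a (a + b) by rewrite /f; ring.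
have f_sum (m : nat) :
    30 * \sum_(1 <= b < m.+1) f m.+1%:Z b%:Z = h m.+1%:Z.
  by rewrite sum_r1 /h intS; ring.
have := sum_quads_rotationZ n_gt0 f_rot f_sum.
have -> : \sum_(t <- quads n)
    (f t.1.1%:Z t.1.2%:Z - f (t.1.1%:Z + t.1.2%:Z) t.1.2%:Z) =
  (-4) * coef (sigma_gf 3 * sigma_gf 3) n.
  rewrite -!sum_quads_mul !mulr_sumr -?big_split /=.
  by apply: eq_bigr => t _; rewrite /f; ring.
have -> : \sum_(d <- divisors n)
    (30 * ((n %/ d)%:Z - 1) * f d%:Z d%:Z - h d%:Z) =
  (-1) * (sigma 7 n)%:Z + (sigma 3 n)%:Z.
  rewrite !sigmaZ !mulr_sumr -!big_split /=.
  by apply: eq_bigr => d _; rewrite /f /h; ring.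
rewrite !coef_fpsE !coef_sigma_gf //.
lia.
Qed.

Lemma sum_q3 (d : int) (m : nat) :
  420 * \sum_(1 <= b < m.+1)
         ((d ^+ 2 - d * b%:Z + b%:Z ^+ 2) ^+ 3) =
    420 * d ^+ 6 * m%:Z - 630 * d ^+ 5 * m%:Z ^+ 2 - 630 * d ^+ 5 * m%:Z +
    840 * d ^+ 4 * m%:Z ^+ 3 + 1260 * d ^+ 4 * m%:Z ^+ 2 +
    420 * d ^+ 4 * m%:Z - 735 * d ^+ 3 * m%:Z ^+ 4 -
    1470 * d ^+ 3 * m%:Z ^+ 3 - 735 * d ^+ 3 * m%:Z ^+ 2 +
    504 * d ^+ 2 * m%:Z ^+ 5 + 1260 * d ^+ 2 * m%:Z ^+ 4 +
    840 * d ^+ 2 * m%:Z ^+ 3 - 84 * d ^+ 2 * m%:Z - 210 * d * m%:Z ^+ 6 -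
    630 * d * m%:Z ^+ 5 - 525 * d * m%:Z ^+ 4 + 105 * d * m%:Z ^+ 2 +
    60 * m%:Z ^+ 7 + 210 * m%:Z ^+ 6 + 210 * m%:Z ^+ 5 - 70 * m%:Z ^+ 3 +
    10 * m%:Z.
Proof.
elim: m => [|m IHm]; first by rewrite big_geq //; ring.
by rewrite big_nat_recr //= mulrDr IHm intS; ring.
Qed.

(** Here [f = q^3], with difference [- 6 a^5 b - 14 a^3 b^3 - 6 a b^5]; the middle term brings in
    the second product. *)
Lemma sigma_conv_1_5 :
  5040 * (sigma_gf 1 * sigma_gf 5) + 5880 * (sigma_gf 3 * sigma_gf 3) =
  249 * sigma_gf 7 + 210 * sigma_gf 5 - 49 * sigma_gf 3 +
    10 * sigma_gf 1 - 420 * euler (sigma_gf 5).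
Proof.
apply: fps_eq_pos => [|n n_gt0].
  by rewrite !(coef_fpsE, coef_fps0M) /=; ring.
pose f (a b : int) := (a ^+ 2 - a * b + b ^+ 2) ^+ 3.
pose h (d : int) := 249 * d ^+ 7 + 210 * d ^+ 5 - 49 * d ^+ 3 +
    10 * d - 420 * d ^+ 6.
have f_rot a b : f (a + b) b = f a (a + b) by rewrite /f; ring.
have f_sum (m : nat) :
    420 * \sum_(1 <= b < m.+1) f m.+1%:Z b%:Z = h m.+1%:Z.
  by rewrite sum_q3 /h intS; ring.
have := sum_quads_rotationZ n_gt0 f_rot f_sum.
have -> : \sum_(t <- quads n)
    (f t.1.1%:Z t.1.2%:Z - f (t.1.1%:Z + t.1.2%:Z) t.1.2%:Z) =
  (-6) * coef (sigma_gf 5 * sigma_gf 1) n +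
    (-14) * coef (sigma_gf 3 * sigma_gf 3) n +
    (-6) * coef (sigma_gf 1 * sigma_gf 5) n.
  rewrite -!sum_quads_mul !mulr_sumr -?big_split /=.
  by apply: eq_bigr => t _; rewrite /f; ring.
have -> : \sum_(d <- divisors n)
    (420 * ((n %/ d)%:Z - 1) * f d%:Z d%:Z - h d%:Z) =
  (-249) * (sigma 7 n)%:Z + (-210) * (sigma 5 n)%:Z + 49 * (sigma 3 n)%:Z +
    (-10) * (sigma 1 n)%:Z + 420 * (n%:Z * (sigma 5 n)%:Z).
  rewrite !sigmaZ !mulr_sumr -!big_split /=.
  apply: eq_big_seq => d; rewrite -dvdn_divisors // => dn.
  by rewrite -{2}(divnK dn) PoszM /f /h; ring.
rewrite (_ : sigma_gf 5 * sigma_gf 1 = sigma_gf 1 * sigma_gf 5);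
  last by rewrite mulrC.
rewrite !coef_fpsE !coef_sigma_gf //.
lia.
Qed.

Lemma sum_q1r1 (d : int) (m : nat) :
  420 * \sum_(1 <= b < m.+1)
         ((d ^+ 2 - d * b%:Z + b%:Z ^+ 2) * (d * b%:Z * (d - b%:Z)) ^+ 2) =
    140 * d ^+ 6 * m%:Z ^+ 3 + 210 * d ^+ 6 * m%:Z ^+ 2 + 70 * d ^+ 6 * m%:Z
    - 315 * d ^+ 5 * m%:Z ^+ 4 - 630 * d ^+ 5 * m%:Z ^+ 3 -
    315 * d ^+ 5 * m%:Z ^+ 2 + 336 * d ^+ 4 * m%:Z ^+ 5 +
    840 * d ^+ 4 * m%:Z ^+ 4 + 560 * d ^+ 4 * m%:Z ^+ 3 - 56 * d ^+ 4 * m%:Z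
    - 210 * d ^+ 3 * m%:Z ^+ 6 - 630 * d ^+ 3 * m%:Z ^+ 5 -
    525 * d ^+ 3 * m%:Z ^+ 4 + 105 * d ^+ 3 * m%:Z ^+ 2 +
    60 * d ^+ 2 * m%:Z ^+ 7 + 210 * d ^+ 2 * m%:Z ^+ 6 +
    210 * d ^+ 2 * m%:Z ^+ 5 - 70 * d ^+ 2 * m%:Z ^+ 3 + 10 * d ^+ 2 * m%:Z.
Proof.
elim: m => [|m IHm]; first by rewrite big_geq //; ring.
by rewrite big_nat_recr //= mulrDr IHm intS; ring.
Qed.

(** Here [f = q r], which again vanishes for [a = b]; the difference is
    [- 6 a^3 b^3 (a^2 + b^2)]. *)
Lemma sigma_conv_3_5 :
  5040 * (sigma_gf 3 * sigma_gf 5) =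
  11 * sigma_gf 9 - 21 * sigma_gf 5 + 10 * sigma_gf 3.
Proof.
apply: fps_eq_pos => [|n n_gt0].
  by rewrite !(coef_fpsE, coef_fps0M) /=; ring.
pose f (a b : int) := (a ^+ 2 - a * b + b ^+ 2) * (a * b * (a - b)) ^+ 2.
pose h (d : int) := 11 * d ^+ 9 - 21 * d ^+ 5 + 10 * d ^+ 3.
have f_rot a b : f (a + b) b = f a (a + b) by rewrite /f; ring.
have f_sum (m : nat) :
    420 * \sum_(1 <= b < m.+1) f m.+1%:Z b%:Z = h m.+1%:Z.
  by rewrite sum_q1r1 /h intS; ring.
have := sum_quads_rotationZ n_gt0 f_rot f_sum.
have -> : \sum_(t <- quads n)
    (f t.1.1%:Z t.1.2%:Z - f (t.1.1%:Z + t.1.2%:Z) t.1.2%:Z) =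
  (-6) * coef (sigma_gf 5 * sigma_gf 3) n +
    (-6) * coef (sigma_gf 3 * sigma_gf 5) n.
  rewrite -!sum_quads_mul !mulr_sumr -?big_split /=.
  by apply: eq_bigr => t _; rewrite /f; ring.
have -> : \sum_(d <- divisors n)
    (420 * ((n %/ d)%:Z - 1) * f d%:Z d%:Z - h d%:Z) =
  (-11) * (sigma 9 n)%:Z + 21 * (sigma 5 n)%:Z + (-10) * (sigma 3 n)%:Z.
  rewrite !sigmaZ !mulr_sumr -!big_split /=.
  by apply: eq_bigr => d _; rewrite /f /h; ring.
rewrite (_ : sigma_gf 5 * sigma_gf 3 = sigma_gf 3 * sigma_gf 5);
  last by rewrite mulrC.
rewrite !coef_fpsE !coef_sigma_gf //.
lia.
Qed.

(** * Eisenstein series and Ramanujan's differential equations *)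

(* Locked, since otherwise [eulerD] applies inside [euler E2]. *)
Definition E2 : fps := locked (1 - 24 * sigma_gf 1).
Definition E4 : fps := 1 + 240 * sigma_gf 3.
Definition E6 : fps := 1 - 504 * sigma_gf 5.
Definition E8 : fps := 1 + 480 * sigma_gf 7.
Definition E10 : fps := 1 - 264 * sigma_gf 9.

Lemma E2E : E2 = 1 - 24 * sigma_gf 1.
Proof. by rewrite /E2 -lock. Qed.

Lemma euler0 : euler 0 = 0.
Proof. exact: (euler_nat 0). Qed.

Definition eulerE := (eulerD, eulerN, eulerM, euler_nat, euler1, euler0).

(** For proofs modulo a known relation [x = y]: once the cofactor [c] is supplied, a ring identity
    remains. *)
Lemma eq_of_multiple (c x y l r : fps) : x = y -> l - r = c * (x - y) -> l = r.
Proof. by move=> ->; rewrite subrr mulr0 => /subr0_eq. Qed.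

Lemma euler_E2 : 12 * euler E2 = E2 ^+ 2 - E4.
Proof.
apply: (eq_of_multiple (c := - 48) sigma_conv_1_1).
by rewrite E2E /E4 !eulerE; ring.
Qed.

Lemma euler_E4 : 3 * euler E4 = E2 * E4 - E6.
Proof.
apply: (eq_of_multiple (c := 24) sigma_conv_1_3).
by rewrite E2E /E4 /E6 !eulerE; ring.
Qed.

Lemma E8E : E8 = E4 ^+ 2.
Proof.
by apply: (eq_of_multiple (c := - 480) sigma_conv_3_3); rewrite /E8 /E4; ring.
Qed.

Lemma euler_E6 : 2 * euler E6 = E2 * E6 - E4 ^+ 2.
Proof.
rewrite -E8E; apply: (@natM_inj 10) => //.
(* As [49 * 120 = 5880], this multiple removes the square of [sigma_gf 3] from [sigma_conv_1_5]. *)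
apply: (eq_of_multiple (c := 24 * 49) sigma_conv_3_3).
have /(congr1 ( *%R (- 24))) conv := sigma_conv_1_5.
apply: (eq_of_multiple (c := 1) conv).
by rewrite E2E /E6 /E8 !eulerE; ring.
Qed.

Lemma E10E : E10 = E4 * E6.
Proof.
apply: (eq_of_multiple (c := 24) sigma_conv_3_5).
by rewrite /E4 /E6 /E10; ring.
Qed.

(** * The product for Delta and its expression by [E4] and [E6] *)

Lemma coef_XnM (m n : nat) (f : fps) :
  coef (fps_poly 'X^m * f) n = if (n < m)%N then 0 else coef f (n - m).
Proof.
rewrite (@coef_fps_mul _ _ 'X^m (fps_trunc n f)) // => [|i le_in].
  by rewrite coefXnM; case: ltnP => // le_mn; rewrite coef_trunc ?leq_subr.
by rewrite coef_trunc.
Qed.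

Lemma fps_polyB : {morph fps_poly : p q / p - q}.
Proof.
by move=> p q; apply: fpsP => n; rewrite coef_fpsD coef_fpsN /= coefB.
Qed.

(* [q^m / (1 - q^m)] *)
Definition geom (m : nat) : fps :=
  Fps (fun n => ((0 < n)%N && (m %| n)%N)%:R).

Lemma geomE (m : nat) : (0 < m)%N ->
  fps_poly (1 - 'X^m) * geom m = fps_poly 'X^m.
Proof.
move=> m_gt0; rewrite fps_polyB mulrBl [fps_poly 1 * _]mul1r.
apply: fpsP => n; rewrite coef_fpsD coef_fpsN coef_XnM /= coefXn.
have [lt_nm|le_mn] := ltnP n m.
  rewrite subr0 ltn_eqF //; case: posnP => //= n_gt0.
  by rewrite gtnNdvd.
rewrite subn_gt0 dvdn_subl // (leq_trans m_gt0 le_mn) /=.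
have [->|neq_nm] := eqVneq n m; first by rewrite dvdnn ltnn subr0.
by rewrite ltn_neqAle eq_sym neq_nm le_mn subrr.
Qed.

Lemma euler_poly_Xn (m : nat) :
  euler (fps_poly 'X^m) = m%:R * fps_poly 'X^m.
Proof.
apply: fpsP => n; rewrite coef_euler coef_fps_natM /= coefXn.
by case: eqVneq => [->|_]; rewrite ?mulr0 // natz.
Qed.

Lemma eulerX (f : fps) (k : nat) :
  euler (f ^+ k) = k%:R * euler f * f ^+ k.-1.
Proof.
elim: k => [|[|k] IHk]; first by rewrite euler1 !mul0r.
  by rewrite expr1 mul1r mulr1.
by rewrite exprS eulerM IHk /= -[in RHS]natr1 -[k.+1%:R]natr1 exprS; ring.
Qed.

(** The logarithmic derivative, free of division: the leading [q] contributes 1, and [(1 - q^m)^24]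
    contributes [- 24 m q^m / (1 - q^m)]. *)
Lemma euler_delta_trunc (n : nat) :
  euler (fps_poly (delta_trunc n)) =
  fps_poly (delta_trunc n) * (1 - 24 * \sum_(1 <= m < n.+1) m%:R * geom m).
Proof.
elim: n => [|n IHn].
  rewrite /delta_trunc !big_geq // mulr1 -['X]expr1 euler_poly_Xn; ring.
have -> : delta_trunc n.+1 = delta_trunc n * (1 - 'X^(n.+1)) ^+ 24.
  by rewrite /delta_trunc big_nat_recr //= mulrA.
have poly_pow p k : fps_poly (p ^+ k) = fps_poly p ^+ k.
  by elim: k => [//|k IHk]; rewrite !exprS fps_polyM IHk.
rewrite fps_polyM eulerM IHn poly_pow eulerX [in RHS]big_nat_recr //=.
(* By [geomE], [q^(n+1)] is a multiple of [1 - q^(n+1)]; this turns the 23rd power left by [eulerX]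
   back into the 24th. *)
rewrite {2}fps_polyB eulerD eulerN [fps_poly 1]/(1 : fps).
rewrite [euler (fps_poly 1)]euler1 euler_poly_Xn -geomE //.
by rewrite [_ ^+ 24]exprS; ring.
Qed.

Definition tau_gf : fps := Fps tau.

(** Up to [q^n] the product truncated at [n] agrees with Delta, and the Lambert series with terms
    [m q^m / (1 - q^m)] agrees with [sigma_gf 1]. *)
Lemma euler_tau : euler tau_gf = E2 * tau_gf.
Proof.
apply: fpsP => n.
transitivity (coef (euler (fps_poly (delta_trunc n))) n).
  by rewrite !coef_euler.
rewrite euler_delta_trunc mulrC !coef_fpsM; apply: eq_bigr => i _.
have le_in : (i <= n)%N by rewrite -ltnS.
congr (_ * _); last by rewrite [LHS]/= delta_truncE ?leq_subr.
rewrite E2E !coef_fpsE; congr (_ - _ * _).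
have coef_sum (r : seq nat) (F : nat -> fps) :
    coef (\sum_(m <- r) F m) i = \sum_(m <- r) coef (F m) i.
  by elim/big_rec2: _ => // m x f _ <-; rewrite coef_fpsD.
rewrite coef_sum; case: (posnP i) => [->|i_gt0].
  by rewrite big1 // => m _; rewrite coef_fps_natM mulr0.
rewrite coef_sigma_gf // sigmaZ.
under eq_bigr => m _ do rewrite coef_fps_natM /= i_gt0 /=.
under [RHS]eq_bigr => m _ do rewrite expr1.
rewrite (eq_bigr (fun m => if (m %| i)%N then m%:Z else 0)); last first.
  by move=> m _; case: ifP; rewrite ?mulr0 ?mulr1 ?natz.
(* Since [i <= n], every divisor of [i] lies in the range of the truncated sum. *)
rewrite -big_mkcond -big_filter; apply: perm_big; apply: uniq_perm.
- by rewrite filter_uniq ?iota_uniq.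
- exact: divisors_uniq.
move=> m; rewrite mem_filter mem_index_iota -dvdn_divisors //.
apply/andP/idP => [[]//|mi]; split=> //.
by rewrite (dvdn_gt0 i_gt0 mi) ltnS (leq_trans (dvdn_leq i_gt0 mi)).
Qed.

(** [E2] has constant term 1, so comparing coefficients gives [f_0 = 0] and, for [n >= 2], expresses
    [(n - 1) f_n] by lower coefficients; only [f_1] is free. *)
Lemma euler_E2M_inj (f g : fps) :
    euler f = E2 * f -> euler g = E2 * g -> coef f 1 = coef g 1 -> f = g.
Proof.
move=> ef eg fg1; apply: fpsP => n.
have E2_0 : coef E2 0 = 1.
  by rewrite E2E !coef_fpsE coef_fps1 [coef _ _]/= mulr0.
have coef0 h : euler h = E2 * h -> coef h 0 = 0.
  by move/(congr1 (coef^~ 0)); rewrite coef_fps0M E2_0 coef_euler mul0r mul1r.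
elim/ltn_ind: n => -[|[|n]] IHn //; first by rewrite !coef0.
have step h : euler h = E2 * h ->
    n.+1%:Z * coef h n.+2 =
    \sum_(i < n.+2) coef E2 i.+1 * coef h (n.+2 - i.+1).
  move/(congr1 (coef^~ n.+2)); rewrite coef_euler coef_fpsM big_ord_recl.
  rewrite [coef E2 _]E2_0 mul1r subn0 => def.
  rewrite -[RHS](addKr (coef h n.+2)).
  rewrite -[X in - _ + X]def.
  by rewrite [n.+2%:Z]intS; ring.
apply: (@mulfI _ n.+1%:Z) => //; rewrite !step //.
by apply: eq_bigr => i _; rewrite IHn // subSS ltnS (leq_trans (leq_subr _ _)).
Qed.

Lemma tauE : 1728 * tau_gf = E4 ^+ 3 - E6 ^+ 2.
Proof.
apply: euler_E2M_inj.
- by rewrite euler_natM euler_tau; ring.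
- rewrite eulerD eulerN !eulerX.
  (* After Ramanujan's equations the cross terms [E4^2 E6] cancel and [E2] factors out. *)
  have -> : 3 * euler E4 * E4 ^+ 2 - 2 * euler E6 * E6 ^+ 1 =
      (E2 * E4 - E6) * E4 ^+ 2 - (E2 * E6 - E4 ^+ 2) * E6.
    by rewrite -euler_E4 -euler_E6.
  ring.
have coefM1 (f g : fps) :
    coef (f * g) 1 = coef f 0 * coef g 1 + coef f 1 * coef g 0.
  by rewrite coef_fpsM !big_ord_recl big_ord0 addr0.
have sigma_n1 k : coef (sigma_gf k) 1 = 1.
  by rewrite coef_sigma_gf // sigmaZ big_seq1 expr1n.
have tau1 : coef tau_gf 1 = 1.
  rewrite /= /tau /delta_trunc coefXM big_nat1 /= -horner_coef0.
  by rewrite horner_exp !hornerE.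
(* On the right the coefficient of [q] is [3 * 240 + 2 * 504 = 1728]. *)
rewrite coef_fps_natM tau1 exprS expr2 !coef_fpsE !coefM1.
rewrite !coef_fps0M /E4 /E6 !coef_fpsE !sigma_n1.
by rewrite !coef_fps1.
Qed.

(** * Reduction to differential polynomials in [E2] *)

Lemma sigma1_E2 : 24 * sigma_gf 1 = 1 - E2.
Proof. by rewrite E2E; ring. Qed.

Lemma E4E : E4 = E2 * E2 - 12 * euler E2.
Proof. by rewrite euler_E2; ring. Qed.

Lemma E6E : E6 = E2 * E2 * E2 - 18 * E2 * euler E2 + 36 * euler (euler E2).
Proof.
have -> : E6 = E2 * E4 - 3 * euler E4 by rewrite euler_E4; ring.
by rewrite E4E !eulerE; ring.
Qed.

(* Chazy's equation *)
Lemma euler3_E2 :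
  2 * euler (euler (euler E2)) =
  2 * E2 * euler (euler E2) - 3 * euler E2 ^+ 2.
Proof.
apply: (@natM_inj 36) => //; apply: (eq_of_multiple (c := 1) euler_E6).
by rewrite E6E E4E !eulerE; ring.
Qed.

(** Chazy's equation carries a factor 2 on the third derivative, so it is no rewrite rule over the
    integers. Its derivative is divisible by 2 and does give a rule for the fourth. *)
Lemma euler4_E2 :
  euler (euler (euler (euler E2))) =
  E2 * euler (euler (euler E2)) - 2 * euler E2 * euler (euler E2).
Proof.
apply: (@natM_inj 2) => //.
apply: (eq_of_multiple (c := 1) (congr1 euler euler3_E2)).
by rewrite ?expr2 !eulerE; ring.
Qed.

Lemma euler5_E2 :
  euler (euler (euler (euler (euler E2)))) =
  E2 * euler (euler (euler (euler E2))) - euler E2 * euler (euler (euler E2))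
  - 2 * euler (euler E2) ^+ 2.
Proof. by rewrite [in LHS]euler4_E2 !eulerE; ring. Qed.

(** In terms of [E2], the coefficients of [E4^3 - E6^2] are divisible by 36 but not all by 72.
    Chazy's equation replaces [3 E2^2 (D E2)^2 - 2 E2^3 D^2 E2] by [- 2 E2^2 D^3 E2], which allows
    division by 72. *)
Lemma tau_E2 :
  24 * tau_gf =
  18 * E2 * euler E2 * euler (euler E2) - E2 ^+ 2 * euler (euler (euler E2))
  - 24 * euler E2 ^+ 3 - 18 * euler (euler E2) ^+ 2.
Proof.
apply: (@natM_inj 72) => //.
have -> : 72 * (24 * tau_gf) = 1728 * tau_gf by ring.
rewrite tauE; apply: (eq_of_multiple (c := 36 * E2 ^+ 2) euler3_E2).
by rewrite E6E E4E; ring.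
Qed.

Lemma sigma3_E2 : 240 * sigma_gf 3 = E2 * E2 - 12 * euler E2 - 1.
Proof. by rewrite -E4E /E4; ring. Qed.

Lemma sigma5_E2 :
  504 * sigma_gf 5 =
  1 - (E2 * E2 * E2 - 18 * E2 * euler E2 + 36 * euler (euler E2)).
Proof. by rewrite -E6E /E6; ring. Qed.

Lemma sigma7_E2 :
  480 * sigma_gf 7 =
  (E2 * E2 - 12 * euler E2) * (E2 * E2 - 12 * euler E2) - 1.
Proof. by rewrite -E4E -expr2 -E8E /E8; ring. Qed.

Lemma sigma9_E2 :
  264 * sigma_gf 9 =
  1 - (E2 * E2 - 12 * euler E2)
      * (E2 * E2 * E2 - 18 * E2 * euler E2 + 36 * euler (euler E2)).
Proof. by rewrite -E4E -E6E -E10E /E10; ring. Qed.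

Definition sigma_E2 := (sigma1_E2, sigma3_E2, sigma5_E2, sigma7_E2, sigma9_E2).

(** * The eight exact identities *)

(** Equivalent to [1728 Delta = 3 E6 D E4 - 2 E4 D E6], a multiple of the first Rankin-Cohen bracket
    of [E4] and [E6]. The constant terms of the Eisenstein series produce the terms linear in the
    divisor sums. *)
Lemma tau_identity_3_5 :
  12 * tau_gf =
    5 * euler (sigma_gf 3) + 7 * euler (sigma_gf 5) +
    840 * (2 * (sigma_gf 3 * euler (sigma_gf 5)) -
    3 * (euler (sigma_gf 3) * sigma_gf 5)).
Proof.
(* With the factor 144, each [sigma_gf k] can be grouped with the constant of its Eisenstein series,
   as [sigma_E2] requires. *)
apply: (@natM_inj 144) => //.
have -> : 144 * (12 * tau_gf) = 72 * (24 * tau_gf) by ring.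
rewrite [RHS](_ : _ =
    3 * (240 * euler (sigma_gf 3)) + 2 * (504 * euler (sigma_gf 5)) +
    2 * ((240 * sigma_gf 3) * (504 * euler (sigma_gf 5))) -
    3 * ((240 * euler (sigma_gf 3)) * (504 * sigma_gf 5)));
  last by ring.
rewrite tau_E2 -!euler_natM !sigma_E2 !eulerE ?euler5_E2 ?euler4_E2.
(* The identity has weight 12 and Chazy's equation weight 8, so the cofactor has weight 4: a
   combination of [E2 ^+ 2] and [euler E2], here and in the identities below. *)
apply: (eq_of_multiple (c := - 432 * euler E2) euler3_E2).
by ring.
Qed.

(** Equivalent to [1536 Delta = 5 D^2 E8 + 6 D E10 - 30 E8 D E2]. *)
Lemma tau_identity_1_7_9 :
  32 * tau_gf =
    15 * euler (sigma_gf 1) + 50 * euler (euler (sigma_gf 7)) -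
    33 * euler (sigma_gf 9) + 7200 * (euler (sigma_gf 1) * sigma_gf 7).
Proof.
apply: (@natM_inj 48) => //.
have -> : 48 * (32 * tau_gf) = 64 * (24 * tau_gf) by ring.
rewrite [RHS](_ : _ =
    30 * (24 * euler (sigma_gf 1)) + 5 * (480 * euler (euler (sigma_gf 7)))
    - 6 * (264 * euler (sigma_gf 9)) +
    30 * ((24 * euler (sigma_gf 1)) * (480 * sigma_gf 7)));
  last by ring.
rewrite tau_E2 -!euler_natM !sigma_E2 !eulerE ?euler5_E2 ?euler4_E2.
apply: (eq_of_multiple (c := - 80 * E2 ^+ 2 + 576 * euler E2) euler3_E2).
by ring.
Qed.

(** Equivalent to [2352 Delta = 6 D^3 E6 + 7 D^2 E8 - 84 E6 D^2 E2]. *)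
Lemma tau_identity_1_5_7 :
  7 * tau_gf =
    6 * euler (euler (sigma_gf 1)) - 9 * euler (euler (euler (sigma_gf 5)))
    + 10 * euler (euler (sigma_gf 7)) +
    3024 * (- (euler (euler (sigma_gf 1)) * sigma_gf 5)).
Proof.
apply: (@natM_inj 336) => //.
have -> : 336 * (7 * tau_gf) = 98 * (24 * tau_gf) by ring.
rewrite [RHS](_ : _ =
    84 * (24 * euler (euler (sigma_gf 1))) -
    6 * (504 * euler (euler (euler (sigma_gf 5)))) +
    7 * (480 * euler (euler (sigma_gf 7))) -
    84 * ((24 * euler (euler (sigma_gf 1))) * (504 * sigma_gf 5)));
  last by ring.
rewrite tau_E2 -!euler_natM !sigma_E2 !eulerE ?euler5_E2 ?euler4_E2.
apply: (eq_of_multiple (c := - 28 * E2 ^+ 2 - 684 * euler E2) euler3_E2).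
by ring.
Qed.

(** Equivalent to [600 Delta = 6 D^4 E4 + 5 D^3 E6 - 70 E4 D^3 E2]. *)
Lemma tau_identity_1_3_5 :
  5 * tau_gf =
    14 * euler (euler (euler (sigma_gf 1))) +
    12 * euler (euler (euler (euler (sigma_gf 3)))) -
    21 * euler (euler (euler (sigma_gf 5))) +
    3360 * (euler (euler (euler (sigma_gf 1))) * sigma_gf 3).
Proof.
apply: (@natM_inj 120) => //.
have -> : 120 * (5 * tau_gf) = 25 * (24 * tau_gf) by ring.
rewrite [RHS](_ : _ =
    70 * (24 * euler (euler (euler (sigma_gf 1)))) +
    6 * (240 * euler (euler (euler (euler (sigma_gf 3))))) -
    5 * (504 * euler (euler (euler (sigma_gf 5)))) +
    70 * ((24 * euler (euler (euler (sigma_gf 1)))) * (240 * sigma_gf 3)));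
  last by ring.
rewrite tau_E2 -!euler_natM !sigma_E2 !eulerE ?euler5_E2 ?euler4_E2.
apply: (eq_of_multiple (c := - 210 * euler E2) euler3_E2).
by ring.
Qed.

(** Equivalent to [2304 Delta = 4 D E10 + 5 E2 D E8 - 40 E8 D E2]. *)
Lemma tau_identity_1_7_9_first_order :
  24 * tau_gf =
    10 * euler (sigma_gf 1) + 25 * euler (sigma_gf 7) -
    11 * euler (sigma_gf 9) + 600 * (- (sigma_gf 1 * euler (sigma_gf 7)) +
    8 * (euler (sigma_gf 1) * sigma_gf 7)).
Proof.
apply: (@natM_inj 96) => //.
rewrite [RHS](_ : _ =
    40 * (24 * euler (sigma_gf 1)) + 5 * (480 * euler (sigma_gf 7)) -
    4 * (264 * euler (sigma_gf 9)) -
    5 * ((24 * sigma_gf 1) * (480 * euler (sigma_gf 7))) +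
    40 * ((24 * euler (sigma_gf 1)) * (480 * sigma_gf 7)));
  last by ring.
rewrite tau_E2 -!euler_natM !sigma_E2 !eulerE ?euler5_E2 ?euler4_E2.
apply: (eq_of_multiple (c := - 120 * E2 ^+ 2 + 864 * euler E2) euler3_E2).
by ring.
Qed.

(** Equivalent to [1344 Delta = D^2 E8 + 12 D E2 D E6 - 36 E6 D^2 E2]; [sigma_gf 5] occurs only in
    the part divisible by 1512. *)
Lemma tau_identity_1_7 :
  14 * tau_gf =
    9 * euler (euler (sigma_gf 1)) + 5 * euler (euler (sigma_gf 7)) +
    1512 * ((euler (sigma_gf 1) * euler (sigma_gf 5)) -
    3 * (euler (euler (sigma_gf 1)) * sigma_gf 5)).
Proof.
apply: (@natM_inj 96) => //.
have -> : 96 * (14 * tau_gf) = 56 * (24 * tau_gf) by ring.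
rewrite [RHS](_ : _ =
    36 * (24 * euler (euler (sigma_gf 1))) +
    (480 * euler (euler (sigma_gf 7))) +
    12 * ((24 * euler (sigma_gf 1)) * (504 * euler (sigma_gf 5))) -
    36 * ((24 * euler (euler (sigma_gf 1))) * (504 * sigma_gf 5)));
  last by ring.
rewrite tau_E2 -!euler_natM !sigma_E2 !eulerE ?euler5_E2 ?euler4_E2.
apply: (eq_of_multiple (c := - 16 * E2 ^+ 2 - 360 * euler E2) euler3_E2).
by ring.
Qed.

(** Equivalent to [840 Delta = D^3 E6 + 42 D^2 E2 D E4 - 56 E4 D^3 E2]. *)
Lemma tau_identity_1_5 :
  5 * tau_gf =
    8 * euler (euler (euler (sigma_gf 1))) -
    3 * euler (euler (euler (sigma_gf 5))) +
    480 * (- 3 * (euler (euler (sigma_gf 1)) * euler (sigma_gf 3)) +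
    4 * (euler (euler (euler (sigma_gf 1))) * sigma_gf 3)).
Proof.
apply: (@natM_inj 168) => //.
have -> : 168 * (5 * tau_gf) = 35 * (24 * tau_gf) by ring.
rewrite [RHS](_ : _ =
    56 * (24 * euler (euler (euler (sigma_gf 1)))) -
    (504 * euler (euler (euler (sigma_gf 5)))) -
    42 * ((24 * euler (euler (sigma_gf 1))) * (240 * euler (sigma_gf 3))) +
    56 * ((24 * euler (euler (euler (sigma_gf 1)))) * (240 * sigma_gf 3)));
  last by ring.
rewrite tau_E2 -!euler_natM !sigma_E2 !eulerE ?euler5_E2 ?euler4_E2.
apply: (eq_of_multiple (c := - 282 * euler E2) euler3_E2).
by ring.
Qed.

(** Equivalent to [1008 Delta = 14 D E2 D E6 - E2 D^2 E6 - 21 E6 D^2 E2]. *)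
Lemma tau_identity_1_5_second_order :
  2 * tau_gf =
    euler (euler (sigma_gf 1)) + euler (euler (sigma_gf 5)) +
    24 * (- (sigma_gf 1 * euler (euler (sigma_gf 5))) +
    14 * (euler (sigma_gf 1) * euler (sigma_gf 5)) -
    21 * (euler (euler (sigma_gf 1)) * sigma_gf 5)).
Proof.
apply: (@natM_inj 504) => //.
have -> : 504 * (2 * tau_gf) = 42 * (24 * tau_gf) by ring.
rewrite [RHS](_ : _ =
    21 * (24 * euler (euler (sigma_gf 1))) +
    (504 * euler (euler (sigma_gf 5))) -
    ((24 * sigma_gf 1) * (504 * euler (euler (sigma_gf 5)))) +
    14 * ((24 * euler (sigma_gf 1)) * (504 * euler (sigma_gf 5))) -
    21 * ((24 * euler (euler (sigma_gf 1))) * (504 * sigma_gf 5)));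
  last by ring.
rewrite tau_E2 -!euler_natM !sigma_E2 !eulerE ?euler5_E2 ?euler4_E2.
apply: (eq_of_multiple (c := - 12 * E2 ^+ 2 - 252 * euler E2) euler3_E2).
by ring.
Qed.

(** * From identities of series to congruences *)

Lemma eq_modz_coef (n k : nat) (f g h : fps) (a b m : int) :
    f = g + k%:R * h -> a = coef f n -> b = coef g n -> m = k%:Z ->
  (a = b %[mod m])%Z.
Proof.
move=> -> -> -> ->; rewrite coef_fpsD coef_fps_natM natz addrC mulrC.
exact: modzMDl.
Qed.

Theorem corollary2p8 (n : nat) (hn : (1 <= n)%N) :
  (12 * tau n = 5 * n%:Z * (sigma 3 n)%:Z + 7 * n%:Z * (sigma 5 n)%:Z
     %[mod 2 ^+ 3 * 3 * 5 * 7])%Z /\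
  (32 * tau n = 15 * n%:Z * (sigma 1 n)%:Z + 50 * n%:Z ^+ 2 * (sigma 7 n)%:Z
                - 33 * n%:Z * (sigma 9 n)%:Z
     %[mod 2 ^+ 5 * 3 ^+ 2 * 5 ^+ 2])%Z /\
  (7 * tau n = 6 * n%:Z ^+ 2 * (sigma 1 n)%:Z - 9 * n%:Z ^+ 3 * (sigma 5 n)%:Z
               + 10 * n%:Z ^+ 2 * (sigma 7 n)%:Z
     %[mod 2 ^+ 4 * 3 ^+ 3 * 7])%Z /\
  (5 * tau n = 14 * n%:Z ^+ 3 * (sigma 1 n)%:Z +
    12 * n%:Z ^+ 4 * (sigma 3 n)%:Z
               - 21 * n%:Z ^+ 3 * (sigma 5 n)%:Z
     %[mod 2 ^+ 5 * 3 * 5 * 7])%Z /\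
  (24 * tau n = 10 * n%:Z * (sigma 1 n)%:Z + 25 * n%:Z * (sigma 7 n)%:Z
                - 11 * n%:Z * (sigma 9 n)%:Z
     %[mod 2 ^+ 3 * 3 * 5 ^+ 2])%Z /\
  (14 * tau n = 9 * n%:Z ^+ 2 * (sigma 1 n)%:Z + 5 * n%:Z ^+ 2 * (sigma 7 n)%:Z
     %[mod 2 ^+ 3 * 3 ^+ 3 * 7])%Z /\
  (5 * tau n = 8 * n%:Z ^+ 3 * (sigma 1 n)%:Z - 3 * n%:Z ^+ 3 * (sigma 5 n)%:Z
     %[mod 2 ^+ 5 * 3 * 5])%Z /\
  (2 * tau n = n%:Z ^+ 2 * (sigma 1 n)%:Z + n%:Z ^+ 2 * (sigma 5 n)%:Z
     %[mod 2 ^+ 3 * 3])%Z.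
Proof.
have tauE_n : coef tau_gf n = tau n by [].
repeat apply: conj.
(* Each [euler] becomes a factor [n], and [ring] also checks that the factored modulus equals the
   constant of the identity, here 840. *)
- by apply: (eq_modz_coef tau_identity_3_5);
    rewrite ?coef_fpsE ?coef_sigma_gf ?tauE_n //; ring.
- by apply: (eq_modz_coef tau_identity_1_7_9);
    rewrite ?coef_fpsE ?coef_sigma_gf ?tauE_n //; ring.
- by apply: (eq_modz_coef tau_identity_1_5_7);
    rewrite ?coef_fpsE ?coef_sigma_gf ?tauE_n //; ring.
- by apply: (eq_modz_coef tau_identity_1_3_5);
    rewrite ?coef_fpsE ?coef_sigma_gf ?tauE_n //; ring.
- by apply: (eq_modz_coef tau_identity_1_7_9_first_order);
    rewrite ?coef_fpsE ?coef_sigma_gf ?tauE_n //; ring.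
- by apply: (eq_modz_coef tau_identity_1_7);
    rewrite ?coef_fpsE ?coef_sigma_gf ?tauE_n //; ring.
- by apply: (eq_modz_coef tau_identity_1_5);
    rewrite ?coef_fpsE ?coef_sigma_gf ?tauE_n //; ring.
- by apply: (eq_modz_coef tau_identity_1_5_second_order);
    rewrite ?coef_fpsE ?coef_sigma_gf ?tauE_n //; ring.
Qed.
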